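(* For any permutation matrix $A$ of order $n$, if $A$ is not the identity matrix, then there are some generalized cycle matrices $P_1,P_2,\dots,P_r$ of type I (of order $n$), such that $$A=P_1P_2\cdots P_r,$$ where $1\le r\le\lfloor n/2\rfloor$; $r$ and $P_i$ ($i=1,2,\dots,r$) are determined by $A$; and $P_{i_1}$ and $P_{i_2}$ commute for $1\le i_1\neq i_2\le r$.
   Context: Let $n$ be a positive integer. A permutation matrix of order $n$ is a square matrix of order $n$ with all entries in $\{0,1\}$ having a unique entry $1$ in every row and every column. $I_n$ denotes the identity matrix of order $n$. A generalized cycle matrix of type I of order $n$ with cycle order $k$ ($2\le k\le n$) is a permutation matrix $C$ of order $n$ such that exactly $k$ diagonal entries of $C$ are $0$, $C^k=I_n$, and $C^i\neq I_n$ for every $i$ with $1\le i<k$. A generalized cycle matrix of type I is one with some cycle order $k$, $2\le k\le n$. *)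

(* Defs.v *)
From HB Require Import structures.
From mathcomp Require Import all_boot all_order all_fingroup all_algebra.

Set Implicit Arguments.
Unset Strict Implicit.
Unset Printing Implicit Defensive.

Import GRing.Theory.
Local Open Scope ring_scope.

(* [is_perm_mx] agrees with the entrywise description: every entry is 0 or 1,
   with a unique 1 in every row and every column. *)
Lemma is_perm_mx_entries (R : nzRingType) (n : nat) (A : 'M[R]_n) :
  is_perm_mx A <->
  [/\ forall i j, A i j = 0 \/ A i j = 1,
      forall i, exists! j, A i j = 1
    & forall j, exists! i, A i j = 1].
Proof.
split=> [/is_perm_mxP[s ->] | [A01 rowA colA]].
  have sE i j : (perm_mx s : 'M[R]_n) i j = (s i == j)%:R by rewrite !mxE.
  have s1 i j : (perm_mx s : 'M[R]_n) i j = 1 <-> s i = j.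
    rewrite sE; split=> [|->]; last by rewrite eqxx.
    by case: eqP => // _ /esym/eqP; rewrite oner_eq0.
  split=> [i j|i|j].
  - by rewrite sE; case: eqP => _; [right | left].
  - by exists (s i); split=> [|j /s1//]; apply/s1.
  - by exists ((s^-1)%g j); split=> [|i /s1 <-]; rewrite ?permK //; apply/s1;
      rewrite permKV.
have ex i : exists j, A i j == 1 by have [j [/eqP Aij _]] := rowA i; exists j.
pose f i := xchoose (ex i).
have Af i : A i (f i) = 1 by apply/eqP; apply: (xchooseP (ex i)).
have f_inj : injective f.
  move=> i1 i2 eqf; have [i [_ uniq_i]] := colA (f i1).
  by rewrite -(uniq_i i1 (Af i1)) -(uniq_i i2) // eqf Af.
apply/is_perm_mxP; exists (perm f_inj); apply/matrixP=> i j; rewrite !mxE permE.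
case: eqP => [<-|neq]; first exact: Af.
case: (A01 i j) => // Aij; case: neq; have [k [_ uniq_k]] := rowA i.
by rewrite -(uniq_k j Aij) -(uniq_k (f i) (Af i)).
Qed.

(* This does not force [C] to be a single cycle: for n = k = 12, a permutation
   of cycle type (4, 3, 3, 2) moves 12 points and has order 12. *)
Definition gen_cycle_mxI_of_order (R : nzRingType) (n : nat) (C : 'M[R]_n)
    (k : nat) : Prop :=
  [/\ (2 <= k <= n)%N,
      is_perm_mx C,
      #|[set i | C i i == 0]| = k,
      C ^+ k = 1%:M
    & forall i : nat, (1 <= i < k)%N -> C ^+ i <> 1%:M].

Definition gen_cycle_mxI (R : nzRingType) (n : nat) (C : 'M[R]_n) : Prop :=
  exists k : nat, gen_cycle_mxI_of_order C k.

(* Main.v *)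
Require Import Defs.
From HB Require Import structures.
From mathcomp Require Import all_boot all_order all_fingroup all_algebra.
From mathcomp Require Import cyclic.

Set Implicit Arguments.
Unset Strict Implicit.
Unset Printing Implicit Defensive.

Import GRing.Theory.
Local Open Scope ring_scope.

(** Decompose the underlying permutation into its disjoint cycles: the factors
    are the restrictions of the permutation to its orbits with at least two
    points.  A cycle of length [k] moves exactly [k] points and has order [k],
    and since the orbits are disjoint and have size at least 2, there are at
    most [n / 2] of them. *)

Definition nontriv_porbits (T : finType) (s : {perm T}) : {set {set T}} :=
  [set X in porbits s | (1 < #|X|)%N].

Lemma perm_fixE (T : finType) (s : {perm T}) (x : T) :
  (s x == x) = (#|porbit s x| <= 1)%N.
Proof.
apply/idP/idP => [/eqP sx | /card_le1_eqP oX].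
  apply/card_le1_eqP => y z /porbitP[i ->] /porbitP[j ->].
  by rewrite !permX_fix.
by apply/eqP/oX; [exact: porbit_id | exact: (mem_porbit s 1)].
Qed.

Lemma mem_porbits (T : finType) (s : {perm T}) (X : {set T}) (x : T) :
  X \in porbits s -> (x \in X) = (X == porbit s x).
Proof.
by case/imsetP=> y _ ->; rewrite eq_porbit_mem porbit_sym.
Qed.

Lemma trivIset_porbits (T : finType) (s : {perm T}) : trivIset (porbits s).
Proof.
apply/trivIsetP => X Y sX sY; apply: contraR => /pred0Pn[x /andP[/= xX xY]].
move: xX xY; rewrite (mem_porbits _ sX) (mem_porbits _ sY).
by move=> /eqP -> /eqP ->.
Qed.

(** [restr_perm X s] defaults to the identity unless [s] stabilizes [X]; this membership makes it
    the genuine restriction. *)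
Lemma porbits_astabs (T : finType) (s : {perm T}) (X : {set T}) :
  X \in porbits s -> s \in ('N(X | 'P))%g.
Proof.
move=> sX; apply/astabsP => x; rewrite /= /aperm !(mem_porbits _ sX).
by rewrite (porbit_perm s 1).
Qed.

Lemma restr_porbitE (T : finType) (s : {perm T}) (X : {set T}) (x : T) :
  X \in porbits s -> restr_perm X s x = if x \in X then s x else x.
Proof.
move=> sX; case: ifPn => xX; first by rewrite restr_permE ?porbits_astabs.
exact: out_perm (restr_perm_on X s) xX.
Qed.

Lemma restr_porbitX (T : finType) (s : {perm T}) (X : {set T}) (x : T) i :
  X \in porbits s ->
  (restr_perm X s ^+ i)%g x = if x \in X then (s ^+ i)%g x else x.
Proof.
move=> sX; rewrite -(morphX (restr_perm_morphism X)) ?porbits_astabs //=.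
case: ifPn => xX; last exact: out_perm (restr_perm_on _ _) xX.
by rewrite restr_permE ?groupX ?porbits_astabs.
Qed.

Lemma card_moved_restr_porbit (T : finType) (s : {perm T}) (X : {set T}) :
  X \in nontriv_porbits s -> #|[set x | restr_perm X s x != x]| = #|X|.
Proof.
rewrite inE => /andP[sX X_gt1]; apply: eq_card => x; rewrite inE.
rewrite restr_porbitE //; case: ifPn => xX; last by rewrite eqxx.
by move: xX; rewrite (mem_porbits _ sX) perm_fixE -ltnNge => /eqP <-.
Qed.

Lemma order_restr_porbit (T : finType) (s : {perm T}) (X : {set T}) :
  X \in porbits s -> #[restr_perm X s]%g = #|X|.
Proof.
move=> sX; have [y _ defX] := imsetP sX.
have yX : y \in X by rewrite defX porbit_id.
have X_gt0 : (0 < #|X|)%N by apply/card_gt0P; exists y.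
apply/eqP; rewrite eqn_leq; apply/andP; split.
  (* Iterating [s] as many times as the size of an orbit returns each of its points to itself. *)
  apply: dvdn_leq => //; rewrite order_dvdn; apply/eqP/permP => x.
  rewrite restr_porbitX // perm1; case: ifP => //.
  by rewrite (mem_porbits _ sX) => /eqP ->; rewrite permX iter_porbit.
(* The first [#|X|] iterates of [y] are pairwise distinct, so an order [o] below [#|X|] would repeat
   [y] at positions [0] and [o]. *)
set o := #[_]%g; rewrite leqNgt; apply/negP => o_ltX.
have /eqP : nth y (traject s y #|X|) o = nth y (traject s y #|X|) 0.
  rewrite !nth_traject //= -permX.
  have /permP/(_ y) := expg_order (restr_perm X s).
  by rewrite restr_porbitX // yX perm1.
rewrite nth_uniq ?size_traject // ?defX ?uniq_traject_porbit //.
by rewrite -leqn0 leqNgt order_gt0.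
Qed.

(** Distinct orbits are disjoint, so the two restrictions have disjoint supports. *)
Lemma commute_restr_porbit (T : finType) (s : {perm T}) (X Y : {set T}) :
  X \in porbits s -> Y \in porbits s ->
  commute (restr_perm X s) (restr_perm Y s).
Proof.
move=> sX sY; have [->//|neqXY] := eqVneq X Y.
apply: perm_onC (restr_perm_on X s) (restr_perm_on Y s) _.
exact: (trivIsetP (trivIset_porbits s)).
Qed.

(** Allowing any duplicate-free list of orbits makes induction on the list possible. *)
Lemma prod_restr_porbit_seq (T : finType) (s : {perm T}) (l : seq {set T}) x :
  uniq l -> {subset l <= porbits s} ->
  (\prod_(X <- l) restr_perm X s)%g x = if porbit s x \in l then s x else x.
Proof.
elim: l x => [|X l IHl] x /=; first by rewrite big_nil perm1.
case/andP=> X'l Ul sl; have sX : X \in porbits s by rewrite sl ?mem_head.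
rewrite big_cons permM IHl //; last by move=> Y lY; rewrite sl ?inE ?lY ?orbT.
rewrite restr_porbitE // inE (mem_porbits _ sX) eq_sym.
(* The factor for [X] acts first and sends [x] to [s x], still in [X]; as [X] does not recur in [l],
   the later factors fix [s x]. *)
case: eqP => //= eqX; have -> : porbit s (s x) = X by rewrite (porbit_perm s 1).
by rewrite (negPf X'l).
Qed.

Lemma prod_restr_porbit (T : finType) (s : {perm T}) :
  (\prod_(X <- enum (nontriv_porbits s)) restr_perm X s)%g = s.
Proof.
apply/permP => x; rewrite prod_restr_porbit_seq ?enum_uniq //; last first.
  by move=> X; rewrite mem_enum inE => /andP[].
(* The orbits left out are singletons, whose points [s] fixes anyway. *)
rewrite mem_enum inE imset_f //= ltnNge -perm_fixE.
by case: eqP => //= ->.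
Qed.

Lemma card_nontriv_porbits (T : finType) (s : {perm T}) :
  (#|nontriv_porbits s| <= #|T| %/ 2)%N.
Proof.
rewrite leq_divRL // -sum_nat_const.
have tiP : trivIset (nontriv_porbits s).
  by apply: trivIsetS (trivIset_porbits s); apply/subsetP => X /[!inE] /andP[].
apply: leq_trans (max_card (mem (cover (nontriv_porbits s)))).
have /eqP <- := tiP.
by apply: leq_sum => X; rewrite inE => /andP[].
Qed.

Lemma card_nontriv_porbits_gt0 (T : finType) (s : {perm T}) :
  s <> 1%g -> (0 < #|nontriv_porbits s|)%N.
Proof.
move=> s_neq1; rewrite card_gt0; apply/eqP => P0; apply: s_neq1.
by rewrite -[LHS]prod_restr_porbit P0 enum_set0 big_nil.
Qed.

(** Row [i] has its 1 in column [s i], and [1] differs from [0] in [R]. This carries orders from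
    permutations to matrices and makes the permutation behind a matrix unique. *)
Lemma perm_mx_inj (R : nzRingType) (n : nat) :
  injective (@perm_mx R n).
Proof.
move=> s t /matrixP eq_st; apply/permP => i; have := eq_st i (s i).
by rewrite !mxE eqxx; case: eqP => // _ /eqP; rewrite oner_eq0.
Qed.

Lemma perm_mxX (R : nzRingType) (n : nat) (s : 'S_n) (i : nat) :
  perm_mx (s ^+ i)%g = (perm_mx s : 'M[R]_n) ^+ i.
Proof.
elim: i => [|i IHi]; first by rewrite perm_mx1.
by rewrite expgS exprS perm_mxM IHi.
Qed.

Lemma perm_mx_prod (R : nzRingType) (n : nat) (I : Type) (l : seq I)
    (F : I -> 'S_n) :
  perm_mx (\prod_(i <- l) F i)%g = \prod_(i <- l) (perm_mx (F i) : 'M[R]_n).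
Proof.
apply: (big_morph (@perm_mx R n)); [exact: perm_mxM | exact: perm_mx1].
Qed.

Lemma gen_cycle_mxI_restr_porbit (R : nzRingType) (n : nat) (s : 'S_n)
    (X : {set 'I_n}) :
  X \in nontriv_porbits s ->
  gen_cycle_mxI (perm_mx (restr_perm X s) : 'M[R]_n).
Proof.
move=> sX; have /[1!inE]/andP[pX X_gt1] := sX.
exists #|X|; split=> [||||i /andP[i_gt0 i_ltX]].
- by rewrite X_gt1 -[leqRHS]card_ord max_card.
- exact: perm_mx_is_perm.
- rewrite -(card_moved_restr_porbit sX); apply: eq_card => i; rewrite !inE !mxE.
  by case: (restr_perm X s i == i); rewrite ?oner_eq0 ?eqxx.
- by rewrite -perm_mxX -(order_restr_porbit pX) expg_order perm_mx1.
rewrite -perm_mxX -perm_mx1 => /perm_mx_inj/eqP.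
by rewrite -order_dvdn order_restr_porbit // gtnNdvd.
Qed.

(** Taking the matrix alone as input expresses that the factors are determined by [A]. The empty
    list is a default for matrices that are not permutation matrices. *)
Definition cycle_factors (R : nzRingType) (n : nat) (A : 'M[R]_n) :
    seq 'M[R]_n :=
  if [pick s : 'S_n | A == perm_mx s] is Some s
  then [seq perm_mx (restr_perm X s) | X <- enum (nontriv_porbits s)]
  else [::].

Lemma cycle_factors_perm_mx (R : nzRingType) (n : nat) (s : 'S_n) :
  cycle_factors (perm_mx s : 'M[R]_n) =
  [seq perm_mx (restr_perm X s) | X <- enum (nontriv_porbits s)].
Proof.
rewrite /cycle_factors; case: pickP => [t /eqP/perm_mx_inj -> //|/(_ s)].
by rewrite eqxx.
Qed.

Theorem theorem2 (R : nzRingType) (n : nat) (n_gt0 : (0 < n)%N) :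
  exists (r : 'M[R]_n -> nat) (P : forall A : 'M[R]_n, 'I_(r A) -> 'M[R]_n),
  forall A : 'M[R]_n, is_perm_mx A -> A <> 1%:M ->
  [/\ (1 <= r A <= n %/ 2)%N,
      forall i : 'I_(r A), gen_cycle_mxI (P A i),
      A = \prod_(i < r A) P A i
    & forall i1 i2 : 'I_(r A), i1 <> i2 -> comm_mx (P A i1) (P A i2)].
Proof.
(* Both witnesses come from the one list [cycle_factors A]: its length and its indexed access. *)
exists (fun A => size (cycle_factors A)), (fun A => tnth (in_tuple _)).
move=> _ /is_perm_mxP[s ->] s_neq1.
have factorP i : exists2 X, X \in nontriv_porbits s &
    tnth (in_tuple (cycle_factors (perm_mx s : 'M[R]_n))) i =
    perm_mx (restr_perm X s).
  have /mapP[X] : tnth (in_tuple (cycle_factors (perm_mx s : 'M[R]_n))) i \in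
      [seq perm_mx (restr_perm X s) | X <- enum (nontriv_porbits s)].
    by rewrite -cycle_factors_perm_mx mem_tnth.
  by rewrite mem_enum; exists X.
split=> [|i||i j _].
- rewrite cycle_factors_perm_mx size_map -cardE -[X in (X %/ 2)%N]card_ord.
  rewrite card_nontriv_porbits andbT card_nontriv_porbits_gt0 // => s1.
  by case: s_neq1; rewrite s1 perm_mx1.
- by have [X sX ->] := factorP i; apply: gen_cycle_mxI_restr_porbit.
(* The product over indices becomes a product over the list, then the matrix of a product of
   permutations. *)
- rewrite -(big_tnth _ _ _ xpredT id) cycle_factors_perm_mx big_map.
  by rewrite -perm_mx_prod prod_restr_porbit.
have [X /[1!inE]/andP[sX _] ->] := factorP i.
have [Y /[1!inE]/andP[sY _] ->] := factorP j.
by rewrite /comm_mx -!perm_mxM (commute_restr_porbit sX sY).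
Qed.
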